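(* Let $Q\subset\mathfrak{S}_5$ with $|Q|=5$ and with the identity permutation $(1,2,3,4,5)\in Q$. Let $$Q_0=\{(1,2,3,4,5),(2,3,4,5,1),(3,4,5,1,2),(4,5,1,2,3),(5,1,2,3,4)\}.$$ If $Q\neq Q_0$, then there exist a set of $5$ events in $3+1$-dimensional Minkowski space and a set of $5$ inertial reference frames that realize $Q$. If $Q=Q_0$, then no such set of $5$ events and $5$ inertial reference frames exists.
   Context: Units are chosen so that the speed of light is $1$. Fix a rest frame of $3+1$-dimensional Minkowski space in which an event $E$ has time coordinate $t(E)\in\mathbb{R}$ and spatial coordinates $\mathbf{w}(E)\in\mathbb{R}^3$. An inertial reference frame is specified by its velocity $\mathbf{v}\in\mathbb{R}^3$ relative to the rest frame, with $\mathbf{v}\cdot\mathbf{v}<1$; in that frame the time coordinate of $E$ is $t^{(\mathbf v)}(E)=\gamma(\mathbf v)\bigl(t(E)-\mathbf{v}\cdot\mathbf{w}(E)\bigr)$, where $\gamma(\mathbf v)=(1-\mathbf v\cdot\mathbf v)^{-1/2}$. Permutations are written in one-line notation $(i_1,\dots,i_5)$, and the observer in a frame sees events $E_1,\dots,E_5$ in order $(i_1,\dots,i_5)$ if $t^{(\mathbf v)}(E_{i_1})<\cdots<t^{(\mathbf v)}(E_{i_5})$ (strict inequalities). A set $Q=\{\pi_1,\dots,\pi_5\}$ is realized by events $E_1,\dots,E_5$ and frames $R_1,\dots,R_5$ if the observer in $R_i$ sees the events in order $\pi_i$ for each $i=1,\dots,5$. *)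

(* Defs.v *)
From mathcomp Require Import all_boot all_order all_algebra all_fingroup.
From mathcomp Require Import reals.

Set Implicit Arguments.
Unset Strict Implicit.
Unset Printing Implicit Defensive.

Import Order.TTheory GRing.Theory Num.Theory.

Local Open Scope ring_scope.

Definition dot (R : realType) (u v : 'rV[R]_3) : R :=
  \sum_(i < 3) u 0 i * v 0 i.

(* Coordinates in the fixed rest frame, with the speed of light equal to 1. *)
Record event (R : realType) : Type :=
  Event { time : R; position : 'rV[R]_3 }.

Record frame (R : realType) : Type :=
  Frame { velocity : 'rV[R]_3; subluminal : dot velocity velocity < 1 }.

Definition gamma (R : realType) (v : 'rV[R]_3) : R :=
  (Num.sqrt (1 - dot v v))^-1.

Definition frame_time (R : realType) (F : frame R) (E : event R) : R :=
  gamma (velocity F) * (time E - dot (velocity F) (position E)).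

(* The events E_1, ..., E_5 are indexed by 'I_5 = {0, ..., 4}. A permutation s
   has one-line notation (i_1, ..., i_5) with i_(k+1) = s k + 1, so s lists the
   labels of the events from the earliest one to the latest one. *)
Definition one_line (s : 'S_5) : seq nat := [seq (s k).+1 | k : 'I_5].

Definition sees (R : realType) (E : 'I_5 -> event R) (F : frame R)
    (s : 'S_5) : Prop :=
  sorted <%R [seq frame_time F (E (s k)) | k : 'I_5].

(* Distinctness of the events, and of the frames when #|Q| = 5, need not be
   required: the inequalities in [sees] are strict, so equal events cannot be
   ordered and a frame sees at most one permutation. *)
Definition realizes (R : realType) (E : 'I_5 -> event R) (F : 'I_5 -> frame R)
    (Q : {set 'S_5}) : Prop :=
  exists p : 'I_5 -> 'S_5,
    Q = [set p i | i : 'I_5] /\ forall i, sees E (F i) (p i).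

Definition Q0 : {set 'S_5} :=
  [set s : 'S_5 | one_line s \in
    [:: [:: 1; 2; 3; 4; 5];
        [:: 2; 3; 4; 5; 1];
        [:: 3; 4; 5; 1; 2];
        [:: 4; 5; 1; 2; 3];
        [:: 5; 1; 2; 3; 4]]%N].

(* Main.v *)
Require Import Defs.
From mathcomp Require Import all_boot all_order all_algebra all_fingroup.
From mathcomp Require Import reals ring lra.

(** An observer only sees the order of the times [t(E) - v.w(E)], and velocities
    can be made small by stretching space, so five orders are realizable as soon
    as the open cones of times compatible with them contain vectors [x_i]
    satisfying a linear relation [sum_i c_i x_i = 0] with coefficients of both
    signs: positive rescaling of the rows then gives [sum_i c_i = 0], and modulo
    one row the matrix of times has rank at most 3.

    For [Q <> Q0] such a relation among at most five of the orders is found by a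
    verified search. Reversing an order negates its cone, so a relation is a
    vanishing sum of vectors from cones; it is looked for by splitting rank
    vectors as sums of two vectors from given cones. A set of orders that already
    contains a relation is not extended.

    For [Q0], the frames being five points of a 3-dimensional affine space, there
    is a relation with [sum_i c_i = 0]; but the increments of cyclically ordered
    times form a Laplacian matrix whose left kernel has constant sign. *)

Set Implicit Arguments.
Unset Strict Implicit.
Unset Printing Implicit Defensive.

Import Order.TTheory GRing.Theory Num.Theory.

Local Open Scope nat_scope.

(** * Search for linear relations *)

Inductive tree (T : Type) : Type := Tip of T | Bin of tree T & tree T.

(* Junk convention: a key that is too short is padded with [false], one that is
   too long is truncated. *)
Fixpoint get (T : Type) (t : tree T) (k : seq bool) : T :=
  match t with
  | Tip x => x
  | Bin l r =>
    match k with
    | [::] => get l [::]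
    | b :: k' => if b then get r k' else get l k'
    end
  end.

Fixpoint tmap (S T : Type) (f : S -> T) (t : tree S) : tree T :=
  match t with
  | Tip x => Tip (f x)
  | Bin l r => Bin (tmap f l) (tmap f r)
  end.

(** Swapping the children at each insertion keeps a tree grown from one leaf balanced, so that its
    keys are short. *)
Fixpoint grow (T : Type) (t : tree T) (x : T) : tree T :=
  match t with
  | Tip y => Bin (Tip y) (Tip x)
  | Bin l r => Bin (grow r x) l
  end.

Fixpoint keys (T : Type) (t : tree T) : seq (seq bool) :=
  match t with
  | Tip _ => [:: [::]]
  | Bin l r => map (cons false) (keys l) ++ map (cons true) (keys r)
  end.

Fixpoint prune (t : tree bool) : tree bool :=
  match t with
  | Tip _ => t
  | Bin l r =>
    match prune l, prune r with
    | Tip false, Tip false => Tip false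
    | l', r' => Bin l' r'
    end
  end.

Fixpoint meet (s t : tree bool) : bool :=
  match s, t with
  | Tip true, Tip true => true
  | Bin l r, Bin l' r' => if meet l l' then true else meet r r'
  | _, _ => false
  end.

Fixpoint marked (t : tree bool) : seq (seq bool) :=
  match t with
  | Tip x => if x then [:: [::]] else [::]
  | Bin l r => map (cons false) (marked l) ++ map (cons true) (marked r)
  end.

Lemma get_tmap (S T : Type) (f : S -> T) t k : get (tmap f t) k = f (get t k).
Proof. by elim: t k => //= l IHl r IHr k; case: k => [|[] k]; rewrite ?IHl ?IHr. Qed.

Lemma get_keys (T : Type) (t : tree T) k :
  exists2 k', k' \in keys t & get t k' = get t k.
Proof.
elim: t k => [x|l IHl r IHr] k /=; first by exists [::].
case: k => [|[] k].
- by have [k' k'l eqk'] := IHl [::]; exists (false :: k'); rewrite // mem_cat map_f.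
- by have [k' k'r eqk'] := IHr k; exists (true :: k'); rewrite // mem_cat map_f ?orbT.
- by have [k' k'l eqk'] := IHl k; exists (false :: k'); rewrite // mem_cat map_f.
Qed.

Lemma get_prune t k : get (prune t) k = get t k.
Proof.
elim: t k => //= l IHl r IHr k; have := IHl; have := IHr.
case: (prune l) => [[]|? ?]; case: (prune r) => [[]|? ?] gr gl;
  by case: k => [|[] k]; rewrite /= -?gl -?gr.
Qed.

Lemma meetP s t : meet s t -> exists2 k, get s k & get t k.
Proof.
elim: s t => [[]|l IHl r IHr] [[]|l' r'] //=; first by exists [::].
case: ifP => [/IHl|_ /IHr] [k sk tk]; first by exists (false :: k).
by exists (true :: k).
Qed.

Lemma markedP t k : k \in marked t -> get t k.
Proof.
elim: t k => [[]|l IHl r IHr] k //=.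
by rewrite mem_cat => /orP[] /mapP[k' k'm ->] /=; [apply: IHl | apply: IHr].
Qed.

(* Under the call-by-value evaluation of [vm_compute], [has] and [sorted] do not
   stop early, since [||] and [&&] evaluate both arguments; [some] and [rising]
   do. *)
Fixpoint some (T : Type) (p : pred T) (s : seq T) : bool :=
  if s is x :: s' then if p x then true else some p s' else false.

Fixpoint rising (T : Type) (r : rel T) (s : seq T) : bool :=
  if s is x :: s' then
    if s' is y :: _ then if r x y then rising r s' else false else true
  else true.

Lemma someE (T : Type) (p : pred T) s : some p s = has p s.
Proof. by elim: s => //= x s ->; case: (p x). Qed.

Lemma risingE (T : Type) (r : rel T) s : rising r s = sorted r s.
Proof. by elim: s => //= x [|y s] //= ->; case: (r x y). Qed.

(** * The orders of five events *)

Definition is_order (o : seq nat) : bool := perm_eq o (iota 0 5).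

Definition orders : tree (seq nat) :=
  foldl (@grow _) (Tip (iota 0 5)) (rem (iota 0 5) (permutations (iota 0 5))).

Definition order_keys : seq (seq bool) := keys orders.

Definition ord (k : seq bool) : seq nat := get orders k.

Definition key_of (o : seq nat) : seq bool :=
  nth [::] order_keys (index o (map ord order_keys)).

Lemma orders_complete : perm_eq (map ord order_keys) (permutations (iota 0 5)).
Proof. by vm_compute. Qed.

Lemma order_keys_uniq : uniq order_keys.
Proof. by vm_compute. Qed.

Lemma mem_orders o : (o \in map ord order_keys) = is_order o.
Proof. by rewrite (perm_mem orders_complete) mem_permutations. Qed.

Lemma ord_is_order k : is_order (ord k).
Proof.
rewrite -mem_orders /ord; have [k' k'in <-] := get_keys orders k.
exact: map_f.
Qed.

Lemma key_ofK o : is_order o -> ord (key_of o) = o.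
Proof.
rewrite -mem_orders => o_in; rewrite /key_of.
have lt_o : index o (map ord order_keys) < size order_keys.
  by rewrite -(size_map ord) index_mem.
by rewrite -(nth_map _ [::]) // nth_index.
Qed.

Lemma key_of_in o : is_order o -> key_of o \in order_keys.
Proof.
by rewrite -mem_orders => o_in; rewrite mem_nth // -(size_map ord) index_mem.
Qed.

Section Orders.
Variable o : seq nat.
Hypothesis oP : is_order o.

Lemma order_size : size o = 5.
Proof. by rewrite (perm_size oP) size_iota. Qed.

Lemma order_uniq : uniq o.
Proof. by rewrite (perm_uniq oP) iota_uniq. Qed.

Lemma mem_order k : (k \in o) = (k < 5).
Proof. by rewrite (perm_mem oP) mem_iota. Qed.

Lemma order_rev : is_order (rev o).
Proof. by rewrite /is_order perm_rev. Qed.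

Lemma order_index : [seq index k o | k <- o] = iota 0 5.
Proof.
apply: (@eq_from_nth _ 0) => [|i]; rewrite size_map order_size ?size_iota // => lti.
by rewrite (nth_map 0) ?order_size // index_uniq ?order_size ?order_uniq // nth_iota.
Qed.

Lemma order_relabel (b : seq nat) :
  is_order b -> is_order [seq index k o | k <- b].
Proof.
move=> bP; rewrite /is_order -order_index; apply: perm_map.
by apply: (perm_trans bP); rewrite perm_sym.
Qed.
End Orders.

Lemma index_relabel a e k : is_order a -> is_order e -> k < 5 ->
  index (index k a) [seq index l a | l <- e] = index k e.
Proof.
move=> aP eP k5; have ke : k \in e by rewrite mem_order.
have -> : index k a = nth 0 [seq index l a | l <- e] (index k e).
  by rewrite (nth_map 0) ?index_mem // nth_index.
by rewrite index_uniq ?size_map ?index_mem ?(order_uniq (order_relabel aP eP)).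
Qed.

(** * Rank vectors and the table of decompositions *)

Definition ranks (o : seq nat) : seq nat := [seq index k o | k <- iota 0 5].

Definition rank_tree : tree (seq nat) := tmap ranks orders.

Definition rank (e : seq bool) : seq nat := get rank_tree e.

Lemma rankE e k : k < 5 -> nth 0 (rank e) k = index k (ord e).
Proof.
by move=> k5; rewrite /rank get_tmap (nth_map 0) ?size_iota // nth_iota.
Qed.

(* The decomposition 5 r = (5 r - z) + z, with z increasing along b and 5 r - z
   increasing along a, is a system of difference constraints on z; [potential]
   runs Bellman-Ford relaxation on it. *)
Fixpoint raise (r z o : seq nat) : seq nat :=
  if o is u :: o' then
    if o' is v :: _ then
      let m := (nth 0 z u + 5 * nth 0 r v).+1 - 5 * nth 0 r u in
      raise r (set_nth 0 z v (maxn (nth 0 z v) m)) o'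
    else z
  else z.

Definition potential (a b r : seq nat) : seq nat :=
  iter 3 (fun z => raise r (raise (nseq 5 0) z b) (rev a)) (nseq 5 0).

(** The potential is checked outright, so no convergence proof is called for. Scale 5 suffices: a
    simple cycle on five events accumulates slack at most 5, and solvability over the reals leaves
    an integral margin of at least 1 in [r]. *)
Definition splits (a b r : seq nat) : bool :=
  let z := potential a b r in
  rising (fun u v => nth 0 z u < nth 0 z v) b &&
  rising (fun u v => 5 * nth 0 r u + nth 0 z v < 5 * nth 0 r v + nth 0 z u) a.

Definition base_table : tree (tree bool) :=
  tmap (fun b => tmap (splits (iota 0 5) b) rank_tree) orders.

Definition relabelling (a : seq nat) : tree (seq bool) :=
  tmap (fun b => key_of [seq index k a | k <- b]) orders.

Definition table : tree (tree (tree bool)) :=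
  tmap (fun a => let c := relabelling a in
    tmap (fun i => prune (tmap (get (get base_table i)) c)) c) orders.

(* [get (decomp a b) e] means that the rank vector of [ord e] is a sum of vectors
   in the cones of [ord a] and [ord b]; [relabelling] reduces this to the case
   where [ord a] is the identity. *)
Definition decomp (a b : seq bool) : tree bool := get (get table a) b.

Definition opp_tree : tree (seq bool) := tmap (fun o => key_of (rev o)) orders.

Definition opp (k : seq bool) : seq bool := get opp_tree k.

Lemma ord_opp k : ord (opp k) = rev (ord k).
Proof. by rewrite /opp get_tmap key_ofK // order_rev // ord_is_order. Qed.

Lemma decomp_splits a b e : get (decomp a b) e ->
  splits (iota 0 5) [seq index k (ord a) | k <- ord b]
    (ranks [seq index k (ord a) | k <- ord e]).
Proof.
have relP k : is_order [seq index l (ord a) | l <- ord k].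
  by rewrite order_relabel ?ord_is_order.
rewrite /decomp get_tmap get_tmap get_prune !get_tmap -/(ord a) -/(ord b) -/(ord e).
by rewrite -!/(ord _) !key_ofK.
Qed.

(* Detects vanishing sums of vectors from the cones of the entries. For five
   entries the sum is [(2 r_g - r_e) + r_e + 2 (- r_g)], where the rank vector
   [r_e] comes from the cones of [b] and [c], and [- r_g] from those of [d] and
   [f]. *)
Definition balanced (L : seq (seq bool)) : bool :=
  match L with
  | [:: a; b; c] => get (decomp a b) (opp c)
  | [:: a; b; c; d] => meet (decomp a b) (decomp (opp c) (opp d))
  | [:: a; b; c; d; f] =>
    some (fun e => let re := rank e in
      some (fun g => let rg := rank g in
          rising (fun u v => 2 * nth 0 rg u + nth 0 re v
                             < 2 * nth 0 rg v + nth 0 re u) (ord a))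
        (marked (decomp (opp d) (opp f))))
      (marked (decomp b c))
  | _ => false
  end.

(** A relation may be negated, so the first sign is fixed as positive; a negative one must then
    occur. *)
Definition signings (n : nat) : seq (seq bool) :=
  [seq s <- iter n (fun l => [seq b :: s | b <- [:: false; true], s <- l]) [:: [::]]
  | ~~ head true s && has id s].

(* A plan lists positions in a sequence of orders together with signs, [true]
   standing for [-1]. *)
Definition signed (ss : seq (seq bool)) (js : seq (seq nat)) :
    seq (seq (bool * nat)) :=
  [seq [seq (nth false s j, j) | j <- l] | s <- ss, l <- js].

Definition plans3 : seq (seq (bool * nat)) :=
  [:: [:: (false, 0); (false, 1); (true, 2)];
      [:: (false, 0); (false, 2); (true, 1)];
      [:: (false, 1); (false, 2); (true, 0)]].

Definition pairings : seq (seq nat) :=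
  [:: [:: 0; 1; 2; 3]; [:: 0; 2; 1; 3]; [:: 0; 3; 1; 2]].

Definition plans4 : seq (seq (bool * nat)) := signed (signings 4) pairings.

(* [rot 2] exchanges the two pairs, which play different roles in [balanced]. *)
Definition plans5 : seq (seq (bool * nat)) :=
  signed (signings 5)
    [seq i :: [seq nth 0 (rem i (iota 0 5)) j | j <- l]
    | i <- iota 0 5, l <- pairings ++ map (rot 2) pairings].

Definition plan_ok (n : nat) (pl : seq (bool * nat)) : bool :=
  [&& uniq (unzip2 pl), all (ltn^~ n) (unzip2 pl), has id (unzip1 pl)
    & has negb (unzip1 pl)].

Lemma plans3_ok : all (plan_ok 3) plans3. Proof. by vm_compute. Qed.
Lemma plans4_ok : all (plan_ok 4) plans4. Proof. by vm_compute. Qed.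
Lemma plans5_ok : all (plan_ok 5) plans5. Proof. by vm_compute. Qed.

Definition flip (b : bool) (k : seq bool) : seq bool := if b then opp k else k.

Definition detected (plans : seq (seq (bool * nat))) (L : seq (seq bool)) : bool :=
  some (fun pl => balanced [seq flip p.1 (nth [::] L p.2) | p <- pl]) plans.

(** * Exhaustive search with pruning *)

Fixpoint pairs (T : Type) (S : seq T) : seq (seq T) :=
  if S is s :: S' then [seq [:: s; t] | t <- S'] ++ pairs S' else [::].

(** During the search, relations avoiding [x] or [y] have been tested at earlier additions. *)
Definition conflict (S : seq (seq bool)) (x y : seq bool) : bool :=
  if some (fun s => detected plans3 [:: s; x; y]) S then true
  else some (fun st => detected plans4 (st ++ [:: x; y])) (pairs S).

Definition rotations : seq (seq nat) := [seq rot i (iota 0 5) | i <- iota 0 5].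

Definition is_cyclic (L : seq (seq bool)) : bool :=
  all (fun k => ord k \in rotations) L.

(** Each candidate set is built in the order of [rest], the inner loop choosing its next member
    [x]. *)
Fixpoint search (n : nat) (S rest : seq (seq bool)) : bool :=
  if n is n'.+1 then
    (fix loop rest := if rest is x :: rest' then
        search n' (x :: S) [seq y <- rest' | ~~ conflict S x y] && loop rest'
      else true) rest
  else if is_cyclic S then true else detected plans5 S.

Definition id_key : seq bool := key_of (iota 0 5).

(** The finite case analysis; its evaluation is left to the kernel at [Qed]. *)
Lemma search_succeeds : search 4 [:: id_key] (rem id_key order_keys).
Proof. by vm_cast_no_check (erefl true). Qed.

Lemma mem_pairs (T : eqType) (S : seq T) (l : seq T) : l \in pairs S ->
  exists s t, l = [:: s; t] /\ subseq [:: s; t] S.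
Proof.
elim: S => //= s S IH; rewrite mem_cat => /orP[/mapP[t tS ->]|/IH[u [v [-> uv]]]].
  by exists s, t; split=> //; rewrite eqxx sub1seq.
exists u, v; split=> //; exact: (subseq_trans uv (subseq_cons S s)).
Qed.

Local Open Scope ring_scope.

(** * Order cones *)

Section Cones.
Variable R : realFieldType.
Implicit Types (o : seq nat) (x u v w : nat -> R) (L : seq (seq bool)).

Definition cone o x : bool := sorted <%R (map x o).

Lemma cone_rev o x : cone (rev o) x -> cone o (fun k => - x k).
Proof.
rewrite /cone map_rev rev_sorted !sorted_map; apply: sub_sorted => i j /=.
by rewrite ltrN2.
Qed.

Lemma coneZ o x a : 0 < a -> cone o x -> cone o (fun k => a * x k).
Proof.
by move=> a0; rewrite /cone !sorted_map; apply: sub_sorted => i j /=; rewrite ltr_pM2l.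
Qed.

Lemma cone_index o : is_order o -> cone o (fun k => (index k o)%:R).
Proof.
move=> oP; rewrite /cone (map_comp (fun n => n%:R) (index^~ o)) order_index //.
by rewrite sorted_map; apply: sub_sorted (iota_ltn_sorted 0 5) => i j /=; rewrite ltr_nat.
Qed.

Lemma splits_cone a b r : splits a b r ->
  exists u v, [/\ cone a u, cone b v & forall k, u k + v k = (nth 0%N r k)%:R].
Proof.
rewrite /splits !risingE; set z := potential a b r => /andP[zb za].
exists (fun k => (nth 0%N r k)%:R - (nth 0%N z k)%:R / 5%:R).
exists (fun k => (nth 0%N z k)%:R / 5%:R); split=> [||k]; last by rewrite subrK.
- rewrite /cone sorted_map; apply: sub_sorted za => i j /=.
  rewrite -(ltr_nat R) !natrD => h; lra.
- rewrite /cone sorted_map; apply: sub_sorted zb => i j /=.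
  by rewrite -(ltr_nat R) => h; lra.
Qed.

Lemma decomp_cone a b e : get (decomp a b) e ->
  exists u v, [/\ cone (ord a) u, cone (ord b) v
    & forall k, (k < 5)%N -> u k + v k = (index k (ord e))%:R].
Proof.
have aP := ord_is_order a; have eP := ord_is_order e.
move=> /decomp_splits /splits_cone[u [v [ua vb uv]]].
(* Event [k] has label [index k (ord a)] in the relabelled problem; composing with this map pulls
   the vectors back. *)
exists (u \o index^~ (ord a)), (v \o index^~ (ord a)); split=> [||k k5].
- by rewrite /cone map_comp order_index.
- by rewrite /cone map_comp.
- rewrite /= uv /ranks (nth_map 0%N) ?size_iota; last first.
    by rewrite -(order_size aP) index_mem mem_order.
  by rewrite nth_iota ?add0n ?index_relabel // -(order_size aP) index_mem mem_order.
Qed.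

Definition null_sum (os : seq (seq nat)) : Prop :=
  exists2 us : nat -> nat -> R,
    forall i, (i < size os)%N -> cone (nth [::] os i) (us i) &
    forall k, (k < 5)%N -> \sum_(i < size os) us i k = 0.

Lemma balanced_null L : balanced L -> null_sum (map ord L).
Proof.
have rows a b e : get (decomp (opp a) (opp b)) e -> exists u v,
    [/\ cone (ord a) u, cone (ord b) v
     & forall k, (k < 5)%N -> u k + v k = - (index k (ord e))%:R].
  move=> /decomp_cone[u [v []]]; rewrite !ord_opp => /cone_rev ua /cone_rev vb uv.
  by exists (fun k => - u k), (fun k => - v k); split=> // k /uv <-; rewrite opprD.
pose us (l : seq (nat -> R)) i := nth (fun=> 0) l i.
case: L => [|a [|b [|c [|d [|f [|? ?]]]]]] //.
- move=> /decomp_cone[u [v [ua vb uv]]].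
  exists (us [:: u; v; fun k => - (index k (ord (opp c)))%:R]) => [[|[|[|i]]] //= _|k k5].
    apply: cone_rev; rewrite ord_opp; apply: cone_index.
    by rewrite order_rev ?ord_is_order.
  by rewrite !big_ord_recl big_ord0 /us /= addr0 addrA uv // subrr.
- move=> /meetP[e /decomp_cone[u [v [ua vb uv]]] /rows[w [t [wc td wt]]]].
  exists (us [:: u; v; w; t]) => [[|[|[|[|i]]]] //= _|k k5].
  by rewrite !big_ord_recl big_ord0 /us /= addr0 addrA uv // wt // subrr.
- rewrite /balanced someE => /hasP[e /markedP /decomp_cone[u [v [ub vc uv]]]].
  rewrite someE => /hasP[g /markedP /rows[w [t [wd tf wt]]]].
  rewrite risingE => ha.
  pose y k : R := 2%:R * (index k (ord g))%:R - (index k (ord e))%:R.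
  exists (us [:: y; u; v; (fun k => 2%:R * w k); (fun k => 2%:R * t k)])
    => [[|[|[|[|[|i]]]]] //= _|k k5]; rewrite ?coneZ ?ltr0n //.
    rewrite /cone sorted_map; move: ha; apply: (@sub_in_sorted _ [in ord a]).
    - move=> i j; rewrite -!topredE /= !mem_order ?ord_is_order // => i5 j5.
      by rewrite !rankE // -(ltr_nat R) !natrD /y => h; lra.
    - exact/allP.
  rewrite !big_ord_recl big_ord0 /us /y /=.
  by move: (uv k k5) (wt k k5) => h1 h2; lra.
Qed.
End Cones.

(** * Dependent sets of orders and soundness of the search *)

Section Dependence.
Variable R : realFieldType.
Implicit Types L S T : seq (seq bool).

(** As [x] is given for every key, a relation extends to larger sets by zero coefficients. *)
Definition dependent L : Prop :=
  exists (c : seq bool -> R) (x : seq bool -> nat -> R),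
    [/\ forall k, cone (ord k) (x k),
        forall i, (i < 5)%N -> \sum_(k <- L) c k * x k i = 0,
        has (fun k => 0 < c k) L & has (fun k => c k < 0) L].

Lemma dependent_sub L L' : uniq L -> uniq L' -> {subset L <= L'} ->
  dependent L -> dependent L'.
Proof.
move=> uL uL' sub [c [x [xc sum0 pos neg]]].
exists (fun k => if k \in L then c k else 0), x; split=> // [i i5||].
- rewrite -[RHS](sum0 i i5) (eq_bigr (fun k => if k \in L then c k * x k i else 0)).
    rewrite -big_mkcond -big_filter; apply: perm_big.
    apply: uniq_perm; rewrite ?filter_uniq // => k; rewrite mem_filter.
    by have [/sub ->|] := boolP (k \in L).
  by move=> k _; case: ifP => //; rewrite mul0r.
- have /hasP[k kL ck] := pos; apply/hasP; exists k; first exact: sub.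
  by rewrite kL.
- have /hasP[k kL ck] := neg; apply/hasP; exists k; first exact: sub.
  by rewrite kL.
Qed.

(** A vector for a reversed order is minus one for the order itself, and the sign moves into the
    coefficient. Keys outside the relation get their rank vectors. *)
Lemma null_sum_dependent (Z : seq (bool * seq bool)) :
  uniq (unzip2 Z) -> has id (unzip1 Z) -> has negb (unzip1 Z) ->
  null_sum R [seq ord (flip z.1 z.2) | z <- Z] -> dependent (unzip2 Z).
Proof.
set K := unzip2 Z; set s := unzip1 Z => uK hasT hasF [us usc us0].
have sizeK : size K = size Z by rewrite size_map.
have sizes : size s = size Z by rewrite size_map.
pose sg i : R := (-1) ^+ nth false s i.
pose ranks0 k i : R := (index i (ord k))%:R.
exists (fun k => sg (index k K)).
exists (fun k => if k \in K then fun i => sg (index k K) * us (index k K) i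
                 else ranks0 k).
split=> [k|i i5||].
- case: ifP => [kK|_]; last by apply: cone_index; apply: ord_is_order.
  have ltk : (index k K < size Z)%N by rewrite -sizeK index_mem.
  move: (index k K) ltk (nth_index [::] kK) => j ltj eqk.
  have := usc j; rewrite size_map => /(_ ltj).
  rewrite (nth_map (false, [::])) // -eqk /K (nth_map (false, [::])) //.
  rewrite /sg /s (nth_map (false, [::])) //.
  case: (nth _ Z j) => [[] k'] /=.
    rewrite ord_opp => /cone_rev; rewrite /cone; apply: etrans.
    by congr sorted; apply: eq_map => i; rewrite mulN1r.
  rewrite /cone; apply: etrans.
  by congr sorted; apply: eq_map => i; rewrite mul1r.
- rewrite -[RHS](us0 i i5) (big_nth [::]) big_mkord size_map sizeK.
  apply: eq_bigr => j _; rewrite mem_nth ?sizeK // index_uniq ?sizeK //.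
  by rewrite /sg mulrA -expr2 sqrr_sign mul1r.
- have /hasP[b bs bF] := hasF.
  have ltb : (index b s < size Z)%N by rewrite -sizes index_mem.
  apply/hasP; exists (nth [::] K (index b s)); first by rewrite mem_nth ?sizeK.
  by rewrite index_uniq ?sizeK // /sg nth_index // (negbTE bF) ltr01.
- have /hasP[b bs bT] := hasT.
  have ltb : (index b s < size Z)%N by rewrite -sizes index_mem.
  apply/hasP; exists (nth [::] K (index b s)); first by rewrite mem_nth ?sizeK.
  by rewrite index_uniq ?sizeK // /sg nth_index // bT ltrN10.
Qed.

Lemma detected_dependent n plans L : all (plan_ok n) plans -> size L = n ->
  uniq L -> detected plans L -> dependent L.
Proof.
move=> /allP ok sizeL uL; rewrite /detected someE => /hasP[pl].
move=> /ok /and4P[upl lts hasT hasF].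
move=> /(balanced_null R); rewrite -map_comp => bal.
pose Z := [seq (p.1, nth [::] L p.2) | p <- pl].
have K_E : unzip2 Z = [seq nth [::] L j | j <- unzip2 pl].
  by rewrite /unzip2 /Z -!map_comp.
have s_E : unzip1 Z = unzip1 pl by rewrite /unzip1 /Z -map_comp.
have uK : uniq (unzip2 Z).
  rewrite K_E map_inj_in_uniq // => i j /(allP lts) iL /(allP lts) jL /eqP.
  by rewrite nth_uniq ?sizeL // => /eqP.
apply: (@dependent_sub (unzip2 Z)) => //.
  by rewrite K_E => _ /mapP[j /(allP lts) jL ->]; rewrite mem_nth ?sizeL.
by apply: null_sum_dependent; rewrite ?s_E // /Z -map_comp.
Qed.

Lemma conflict_dependent S x y L : uniq L -> uniq [:: y, x & S] ->
  {subset [:: y, x & S] <= L} -> conflict S x y -> dependent L.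
Proof.
move=> uL /= /and3P[]; rewrite inE negb_or => /andP[yx yS] xS uS sub.
rewrite /conflict !someE; case: ifP => [/hasP[s sS det] _|_ /hasP[st]].
  have us : uniq [:: s; x; y].
    rewrite /= !inE negb_or (memPn yS s sS) (memPn xS s sS) eq_sym yx.
    by rewrite andbT.
  have dep := @detected_dependent 3 _ [:: s; x; y] plans3_ok erefl us det.
  apply: dependent_sub us uL _ dep.
  by move=> k; rewrite !inE => kin; apply: sub; rewrite !inE;
     case/or3P: kin => /eqP ->; rewrite ?sS ?eqxx ?orbT.
move=> /mem_pairs[s [t [-> sub_st]]] det.
have ust := subseq_uniq sub_st uS; have memst := mem_subseq sub_st.
have us : uniq ([:: s; t] ++ [:: x; y]).
  rewrite cat_uniq ust; apply/and3P; split=> //; last by rewrite /= inE eq_sym yx.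
  have nin z : z \notin S -> z \notin [:: s; t] by apply: contra; exact: memst.
  by apply/hasPn => z; rewrite !inE => /orP[] /eqP ->;
    [have := nin _ xS | have := nin _ yS]; rewrite !inE.
have dep := @detected_dependent 4 _ [:: s; t; x; y] plans4_ok erefl us det.
apply: dependent_sub us uL _ dep.
by move=> k; rewrite mem_cat => /orP[/memst kS|];
   [|rewrite !inE => /orP[] /eqP ->]; apply: sub; rewrite !inE ?kS ?eqxx ?orbT.
Qed.

(** [T] is the part of a candidate still to be added. Once its head [x] is chosen, either a later
    member conflicts with [x], which gives a relation inside the candidate, or the whole tail
    survives the filter. *)
Lemma search_sound n S rest T : search n S rest -> subseq T rest ->
  size T = n -> (size S + n = 5)%N -> uniq (catrev T S) ->
  is_cyclic (catrev T S) \/ dependent (catrev T S).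
Proof.
elim: n S rest T => [|n IH] S rest T.
  move=> srch _ /size0nil ->; rewrite addn0 /= => sizeS uS.
  move: srch => /=; case: ifP => [|_ det]; [by left | right].
  exact: detected_dependent plans5_ok sizeS uS det.
elim: rest T => [|x rest IHr] [|y T] // /=.
move=> /andP[srch srch']; case: eqP => [->|_] sub; last exact: (IHr (y :: T) srch' sub).
case=> sizeT sizeS uT.
have [cf|ncf] := boolP (has (conflict S x) T).
  have /hasP[z zT cfz] := cf; right; apply: conflict_dependent (cfz) => //.
    rewrite catrevE in uT; rewrite /= inE.
    move: uT; rewrite cat_uniq rev_uniq => /and3P[uT /hasPn nT uxS].
    rewrite negb_or -andbA; apply/and3P; split=> //.
      by apply: contraNneq (nT x (mem_head _ _)) => <-; rewrite mem_rev.
    by apply: contraL zT => zS; rewrite -mem_rev; apply: nT; rewrite inE zS orbT.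
  move=> k; rewrite catrevE mem_cat mem_rev inE => /orP[/eqP ->|->]; first by rewrite zT.
  by rewrite orbT.
apply: (IH (x :: S) _ T srch) => //; last by rewrite /= addSnnS.
by rewrite subseq_filter sub andbT all_predC.
Qed.

Lemma perm_catrev_rem (T : eqType) (k : T) (s L : seq T) :
  uniq s -> uniq L -> k \in L -> {subset L <= s} ->
  perm_eq (catrev [seq x <- rem k s | x \in L] [:: k]) L.
Proof.
move=> us uL kL sub; rewrite catrevE perm_catC /=.
apply: uniq_perm => // [|x].
  by rewrite /= rev_uniq filter_uniq ?rem_uniq // mem_rev mem_filter mem_rem_uniqF ?andbF.
rewrite inE mem_rev mem_filter mem_rem_uniq // [X in _ || _ && X]inE /=.
have [->|_] := eqVneq x k; first by rewrite kL.
by case xL : (x \in L); rewrite // sub.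
Qed.

Lemma cyclic_or_dependent L : uniq L -> size L = 5%N -> id_key \in L ->
  {subset L <= order_keys} -> is_cyclic L \/ dependent L.
Proof.
move=> uL sizeL idL sub; have srch := search_succeeds.
have pL := perm_catrev_rem order_keys_uniq uL idL sub.
move: (rem id_key order_keys) srch pL => rest srch pL.
set T := [seq x <- rest | x \in L] in pL.
have sizeT : size T = 4%N.
  by have := perm_size pL; rewrite catrevE size_cat size_rev sizeL addn1 => -[].
have uT : uniq (catrev T [:: id_key]) by rewrite (perm_uniq pL).
have [cyc|dep] := search_sound srch (filter_subseq _ _) sizeT erefl uT.
  left; apply/allP => k; rewrite -(perm_mem pL); move: k; exact/allP.
by right; apply: dependent_sub uT uL _ dep => k; rewrite (perm_mem pL).
Qed.
End Dependence.

(** * Realizability *)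

(** The middle factor of the rank normal form factors through dimension [r]. Up to scale, rows of
    [V] will be velocities and columns of [W] positions. *)
Lemma low_rank_factor (F : fieldType) (m n r : nat) (A : 'M[F]_(m, n)) :
  (\rank A <= r)%N ->
  exists (V : 'M[F]_(m, r)) (W : 'M[F]_(r, n)), A = V *m W.
Proof.
move=> rk; exists (col_ebase A *m pid_mx (\rank A)), (pid_mx (\rank A) *m row_ebase A).
by rewrite mulmxA -[_ *m _ *m pid_mx _]mulmxA mul_pid_mx minnn (minn_idPr rk) mulmx_ebase.
Qed.

Lemma gamma_gt0 (R : realType) (F : frame R) : 0 < gamma (velocity F).
Proof. by rewrite invr_gt0 sqrtr_gt0 subr_gt0 subluminal. Qed.

Lemma sees_frame_time (R : realType) (E : 'I_5 -> event R) (F : frame R) (s : 'S_5) :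
  sees E F s <->
  sorted <%R [seq time (E (s k)) - dot (velocity F) (position (E (s k))) | k : 'I_5].
Proof.
rewrite /sees /frame_time !sorted_map.
pose t k := time (E (s k)) - dot (velocity F) (position (E (s k))).
have e : relpre (fun k => gamma (velocity F) * t k) <%R =2 relpre t <%R.
  by move=> a b /=; rewrite ltr_pM2l // gamma_gt0.
by rewrite (eq_sorted e).
Qed.

(* Dividing the row of times of frame [i] by [l i > 0] preserves its order and
   multiplies the coefficient [c i] by [l i]. *)
Lemma normalize_coefficients (R : realFieldType) (n : nat) (c : 'I_n -> R) :
  (exists i, 0 < c i) -> (exists i, c i < 0) ->
  exists2 l : 'I_n -> R, forall i, 0 < l i & \sum_i c i * l i = 0.
Proof.
move=> [i ci] [j cj].
pose P := \sum_(i | 0 < c i) c i; pose N := - \sum_(i | c i < 0) c i.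
have P0 : 0 < P.
  rewrite /P (bigD1 i) //= ltr_pwDl // sumr_ge0 // => k /andP[k0 _]; exact: ltW.
have N0 : 0 < N.
  rewrite /N -sumrN (bigD1 j) //= ltr_pwDl ?oppr_gt0 // sumr_ge0 // => k /andP[k0 _].
  by rewrite oppr_ge0 ltW.
exists (fun i => if 0 < c i then N else P) => [k|]; first by case: ifP.
rewrite (bigID (fun i => 0 < c i)) /= (eq_bigr (fun i => c i * N)); last by move=> k ->.
rewrite -mulr_suml -/P [X in _ + X](_ : _ = (- N) * P).
  by rewrite mulNr mulrC subrr.
rewrite /N opprK mulr_suml [in RHS]big_mkcond [in LHS]big_mkcond.
apply: eq_bigr => k _ /=; case: (ltgtP 0 (c k)) => //= <-.
by rewrite mul0r.
Qed.

Lemma realizable_times (R : realType) (c : 'I_5 -> R) (M : 'I_5 -> 'I_5 -> R)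
    (p : 'I_5 -> 'S_5) :
  (forall i, sorted <%R [seq M i (p i k) | k : 'I_5]) ->
  (forall j, \sum_i c i * M i j = 0) ->
  (exists i, 0 < c i) -> (exists i, c i < 0) ->
  exists (E : 'I_5 -> event R) (F : 'I_5 -> frame R), forall i, sees E (F i) (p i).
Proof.
move=> Msorted cM cpos cneg.
have [l l0 cl] := normalize_coefficients cpos cneg.
pose T i j := M i j / l i.
have [i1 ci1] := cpos; have [i0 ci0] := cneg.
pose c' i := c i * l i.
have c'T j : \sum_i c' i * T i j = 0.
  rewrite -[RHS](cM j); apply: eq_bigr => i _.
  by rewrite /c' /T mulrACA mulfV ?mulr1 // gt_eqF.
pose D : 'M[R]_5 := \matrix_(i, j) (T i j - T i1 j).
(* Two independent left null vectors of [D]: the unit vector at [i1], whose row in [D] is zero, and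
   the rescaled coefficients, which sum to zero. Hence [D] has rank at most 5 - 2. *)
pose K : 'M[R]_(2, 5) := \matrix_(a, i) if a == 0 then (i == i1)%:R else c' i.
have KD : K *m D = 0.
  apply/matrixP => a j; rewrite !mxE; case: (eqVneq a 0) => a0.
    rewrite (bigD1 i1) //= !mxE a0 !eqxx subrr mulr0 add0r big1 // => i /negbTE ii1.
    by rewrite !mxE eqxx ii1 mul0r.
  rewrite (eq_bigr (fun i => c' i * T i j - c' i * T i1 j)); last first.
    by move=> i _; rewrite !mxE (negbTE a0) mulrBr.
  by rewrite sumrB c'T -mulr_suml cl mul0r subrr.
have rankK : \rank K = 2%N.
  apply/eqP; rewrite -/(row_free K) -kermx_eq0; apply/rowV0P => u /sub_kermxP uK.
  have i01 : i0 != i1 by apply: contraTneq ci0 => ->; rewrite -leNgt ltW.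
  have E i : u 0 0 * (i == i1)%:R + u 0 1 * c' i = 0.
    have /matrixP/(_ 0 i) := uK; rewrite !mxE !big_ord_recl big_ord0 !mxE addr0 /=.
    by rewrite (_ : lift ord0 ord0 = 1) //; apply: val_inj.
  have u1 : u 0 1 = 0.
    have /eqP := E i0; rewrite (negbTE i01) mulr0 add0r mulf_eq0 => /orP[/eqP //|].
    by rewrite mulf_eq0 lt_eqF //= gt_eqF.
  have u0 : u 0 0 = 0 by have := E i1; rewrite eqxx mulr1 u1 mul0r addr0.
  apply/rowP => a; rewrite mxE; case: a => [[|[|//]] lt2].
    by rewrite -u0; congr (u _ _); apply: val_inj.
  by rewrite -u1; congr (u _ _); apply: val_inj.
have rankD : (\rank D <= 3)%N.
  by have := mulmx0_rank_max KD; rewrite rankK -[5%N]/(2 + 3)%N leq_add2l.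
have [V [W VW]] := low_rank_factor rankD.
pose s : R := \sum_i dot (row i V) (row i V).
have dot_ge0 (v : 'rV[R]_3) : 0 <= dot v v.
  by apply: sumr_ge0 => k _; rewrite -expr2 sqr_ge0.
have s0 : 0 <= s by apply: sumr_ge0.
have V_le i : dot (row i V) (row i V) <= s.
  by rewrite /s (bigD1 i) //= lerDl sumr_ge0.
(* Velocities shrink by [e] and positions stretch by its inverse; as [e ^+ 2 * s < 1], every frame
   is slower than light. *)
pose e := (1 + s)^-1.
have e_gt0 : 0 < e by rewrite invr_gt0 ltr_pwDl.
have slow i : dot (- e *: row i V) (- e *: row i V) < 1.
  have -> : dot (- e *: row i V) (- e *: row i V) = e ^+ 2 * dot (row i V) (row i V).
    by rewrite /dot mulr_sumr; apply: eq_bigr => k _; rewrite !mxE; ring.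
  have es : e * (1 + s) = 1 by rewrite mulVf // gt_eqF // ltr_pwDl.
  have := V_le i; move: (dot _ _) => d ds.
  have ed : e ^+ 2 * d <= e ^+ 2 * s by rewrite ler_pM2l // exprn_gt0.
  by nra.
(* The sign of the velocity cancels the one in the frame time, so frame [i] reads
   [T i1 j + D i j = T i j] up to its gamma factor. *)
exists (fun j => Event (T i1 j) (e^-1 *: (col j W)^T)), (fun i => Frame (slow i)).
move=> i; apply/sees_frame_time => /=.
rewrite (_ : [seq _ | k : 'I_5] = [seq T i (p i k) | k : 'I_5]).
  by have := Msorted i; rewrite !sorted_map; apply: sub_sorted => a b /=;
     rewrite /T ltr_pM2r // invr_gt0.
apply: eq_map => k; set j := p i k.
have -> : T i j = T i1 j + D i j by rewrite mxE addrC subrK.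
congr (_ + _); rewrite VW mxE /dot -sumrN; apply: eq_bigr => a _.
by rewrite !mxE mulNr mulNr opprK mulrACA mulfV ?mul1r // gt_eqF.
Qed.

(** * Permutations as orders, and realizability of sets other than [Q0] *)

Definition word (s : 'S_5) : seq nat := [seq val (s k) | k <- enum 'I_5].

Lemma one_lineE s : one_line s = map succn (word s).
Proof. by rewrite /one_line /word -map_comp. Qed.

Lemma word_inj : injective word.
Proof.
move=> s t /eq_in_map st; apply/permP => k; apply: val_inj.
by apply: st; rewrite mem_enum.
Qed.

Lemma word_is_order s : is_order (word s).
Proof.
apply: uniq_perm; [|exact: iota_uniq|move=> i].
  by rewrite map_inj_uniq ?enum_uniq // => k l /val_inj /perm_inj.
rewrite mem_iota; apply/idP/idP => [/mapP[k _ ->]|i5]; first exact: ltn_ord.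
by apply/mapP; exists (s^-1%g (Ordinal i5)); rewrite ?mem_enum // permKV.
Qed.

Definition perm_key (s : 'S_5) : seq bool := key_of (word s).

Lemma ord_perm_key s : ord (perm_key s) = word s.
Proof. by rewrite key_ofK // word_is_order. Qed.

Lemma perm_key_inj : injective perm_key.
Proof. by move=> s t st; apply: word_inj; rewrite -!ord_perm_key st. Qed.

Lemma Q0_rotations s : (s \in Q0) = (word s \in rotations).
Proof. by rewrite inE one_lineE -[RHS](mem_map (inj_map succn_inj)). Qed.

Lemma card_Q0 : (#|Q0| <= 5)%N.
Proof.
rewrite cardE -(size_map word).
apply: (@uniq_leq_size _ _ rotations); first by rewrite (map_inj_uniq word_inj) enum_uniq.
by move=> _ /mapP[s sQ ->]; rewrite -Q0_rotations -mem_enum.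
Qed.

Lemma dependent_realizes (R : realType) (Q : {set 'S_5}) : #|Q| = 5%N ->
  dependent R (map perm_key (enum Q)) ->
  exists (E : 'I_5 -> event R) (F : 'I_5 -> frame R), realizes E F Q.
Proof.
move=> cardQ [c [x [xc sum0 pos neg]]].
have sizeQ : size (enum Q) = 5%N by rewrite -cardE.
pose p (i : 'I_5) : 'S_5 := nth 1%g (enum Q) i.
have onto s : s \in Q -> exists i, p i = s.
  rewrite -mem_enum => sQ; have := sQ; rewrite -index_mem sizeQ => lt5.
  by exists (Ordinal lt5); rewrite /p nth_index.
have has_p (P : pred (seq bool)) :
    has P (map perm_key (enum Q)) -> exists i, P (perm_key (p i)).
  by rewrite has_map => /hasP[s]; rewrite mem_enum => /onto[i <-]; exists i.
have [||||E [F EF]] := @realizable_times R (fun i => c (perm_key (p i)))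
  (fun i j => x (perm_key (p i)) j) p.
- move=> i; have := xc (perm_key (p i)); rewrite /cone ord_perm_key !sorted_map.
  by [].
- move=> j; rewrite -[RHS](sum0 j (ltn_ord j)) big_map.
  by rewrite [RHS](big_nth 1%g) sizeQ big_mkord.
- exact: (has_p (fun k => 0 < c k) pos).
- exact: (has_p (fun k => c k < 0) neg).
exists E, F, p; split=> //; apply/setP => s; apply/idP/imsetP => [/onto[i <-]|[i _ ->]].
  by exists i.
by rewrite -mem_enum mem_nth ?sizeQ.
Qed.

Lemma word1 : word 1%g = iota 0 5.
Proof. by rewrite /word (eq_map (g := val)) ?val_enum_ord // => k; rewrite perm1. Qed.

Lemma realizable_not_Q0 (R : realType) (Q : {set 'S_5}) :
  #|Q| = 5%N -> 1%g \in Q -> Q <> Q0 ->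
  exists (E : 'I_5 -> event R) (F : 'I_5 -> frame R), realizes E F Q.
Proof.
move=> cardQ idQ neqQ0; apply: dependent_realizes => //.
set L := map perm_key (enum Q).
have uL : uniq L by rewrite (map_inj_uniq perm_key_inj) enum_uniq.
have idL : id_key \in L.
  have : perm_key 1%g \in L by rewrite map_f ?mem_enum.
  by rewrite /perm_key word1.
have sizeL : size L = 5%N by rewrite size_map -cardE.
have sub : {subset L <= order_keys}.
  by move=> _ /mapP[s _ ->]; apply: key_of_in; apply: word_is_order.
have [cyc|//] := cyclic_or_dependent R uL sizeL idL sub.
case: neqQ0; apply/eqP; rewrite eqEcard cardQ card_Q0 andbT; apply/subsetP => s sQ.
rewrite Q0_rotations -ord_perm_key; have /allP := cyc; apply.
by rewrite map_f ?mem_enum.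
Qed.

(** * Nonrealizability of the cyclic orders *)

(* If event l is preceded by event l - 1 in every frame m <> l, the increments
   T m l - T m (l - 1) form, up to sign, the Laplacian of a complete digraph:
   rows sum to 0 and off-diagonal entries are positive, so its left kernel is
   spanned by a vector of constant sign. *)
Lemma cyclic_orders_independent (R : realFieldType) (c : 'I_5 -> R)
    (T : 'I_5 -> 'I_5 -> R) :
  (forall m l, l != m -> T m (l - 1) < T m l) ->
  (forall l, \sum_m c m * T m l = 0) -> \sum_m c m = 0 -> forall m, c m = 0.
Proof.
move=> inc cT c0 m; apply/eqP; apply: contraT => cm.
pose e m l := T m l - T m (l - 1).
have e_gt0 k l : l != k -> 0 < e k l by move=> lk; rewrite subr_gt0 inc.
(* Here [l - 1] is taken modulo 5, so the increments telescope around the cycle. *)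
have e_sum k : \sum_l e k l = 0.
  rewrite sumrB (reindex_inj (addIr (-1 : 'I_5))) /=.
  by rewrite subrr.
have ce l : \sum_k c k * e k l = 0.
  rewrite (eq_bigr (fun k => c k * T k l - c k * T k (l - 1))); last first.
    by move=> k _; rewrite mulrBr.
  by rewrite sumrB !cT subrr.
have opposite : (exists i, 0 < c i) /\ (exists i, c i < 0).
  suff: [exists i, 0 < c i] && [exists i, c i < 0].
    by case/andP => /existsP ? /existsP ?.
  have cn0 : \sum_k - c k = 0 by rewrite sumrN c0 oppr0.
  rewrite -[_ && _]negbK negb_and !negb_exists; apply/negP => /orP[] /forallP h.
    have h' k : 0 <= - c k by rewrite oppr_ge0 leNgt h.
    have /eqP := cn0; rewrite psumr_eq0 => [/allP/(_ m)|k _] //.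
    by rewrite mem_index_enum oppr_eq0 (negbTE cm) => /(_ isT).
  have h' k : 0 <= c k by rewrite leNgt h.
  have /eqP := c0; rewrite psumr_eq0 => [/allP/(_ m)|k _] //.
  by rewrite mem_index_enum (negbTE cm) => /(_ isT).
case: opposite => [[i ci] [j cj]].
(* Add the relations of the columns with [0 < c l]. A row with positive coefficient has nonpositive
   partial sum, its full sum being zero; every other row has a nonnegative one. So no term is
   positive, and that of row [j] is negative. *)
have S0 : \sum_k c k * (\sum_(l | 0 < c l) e k l) = 0.
  rewrite (eq_bigr (fun k => \sum_(l | 0 < c l) c k * e k l)); last first.
    by move=> k _; rewrite mulr_sumr.
  by rewrite exchange_big big1.
have le0 k : c k * (\sum_(l | 0 < c l) e k l) <= 0.
  have [ck|ck] := ltP 0 (c k).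
    rewrite pmulr_rle0 //; have /eqP := e_sum k.
    rewrite (bigID (fun l => 0 < c l)) /= addr_eq0 => /eqP ->.
    rewrite oppr_le0 sumr_ge0 // => l cl; apply/ltW/e_gt0.
    by apply: contraNneq cl => ->.
  rewrite mulr_le0_ge0 // sumr_ge0 // => l cl; apply/ltW/e_gt0.
  by apply: contraTneq cl => ->; rewrite -leNgt.
suff: \sum_k c k * (\sum_(l | 0 < c l) e k l) < 0 by rewrite S0 ltxx.
rewrite (bigD1 j) //= -[ltRHS]addr0 ltr_leD ?sumr_le0 // nmulr_rlt0 //.
have ej l : 0 < c l -> 0 < e j l.
  by move=> cl; apply: e_gt0; apply: contraTneq cl => ->; rewrite -leNgt ltW.
rewrite (bigD1 i) //= ltr_pwDl ?ej // sumr_ge0 // => l /andP[cl _].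
exact/ltW/ej.
Qed.

(** Five points of affine 3-space are affinely dependent: a matrix with 5 rows and 4 columns has a
    left null vector, and its column of ones makes the coefficients sum to zero. *)
Lemma velocities_dependent (R : realType) (v : 'I_5 -> 'rV[R]_3) :
  exists2 c : 'I_5 -> R, exists m, c m != 0 &
    \sum_m c m = 0 /\ forall w, \sum_m c m * dot (v m) w = 0.
Proof.
pose A : 'M[R]_(5, 1 + 3) := row_mx (const_mx 1) (\matrix_m v m).
have kA : kermx A != 0.
  rewrite kermx_eq0 /row_free; have := rank_leq_col A.
  by apply: contraTneq => ->.
have /rowV0Pn[u /sub_kermxP uA u0] := kA.
move: uA; rewrite mul_mx_row => /eqP; rewrite row_mx_eq0 => /andP[/eqP u1 /eqP uV].
exists (fun m => u 0 m); first by have /rV0Pn[m um] := u0; exists m.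
split=> [|w].
  have /matrixP/(_ 0 0) := u1; rewrite !mxE => e; rewrite -[RHS]e.
  by apply: eq_bigr => m _; rewrite mxE mulr1.
rewrite (eq_bigr (fun m => \sum_k u 0 m * v m 0 k * w 0 k)); last first.
  by move=> m _; rewrite mulr_sumr; apply: eq_bigr => k _; rewrite mulrA.
rewrite exchange_big big1 // => k _; rewrite -mulr_suml.
have /matrixP/(_ 0 k) := uV; rewrite !mxE => uk.
rewrite (eq_bigr (fun m => u 0 m * (\matrix_m v m) m k)) ?uk ?mul0r // => m _.
by rewrite mxE.
Qed.

(** Addition modulo 5, giving the rotation that starts with event [m]. *)
Definition shift (m : 'I_5) : 'S_5 := perm (addrI m).

Lemma shift_Q0 m : shift m \in Q0.
Proof.
have e : word (shift m) = map (fun k => (m + k) %% 5)%N (iota 0 5).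
  by rewrite /word -val_enum_ord -map_comp; apply: eq_map => k; rewrite permE.
rewrite Q0_rotations e.
by case: m {e} => [[|[|[|[|[|]]]]]].
Qed.

(** Event [l] stands at position [l - m], which is positive, so the entry just before it is
    [l - 1]. *)
Lemma sees_shift (R : realType) (E : 'I_5 -> event R) (F : frame R) m l :
  sees E F (shift m) -> l != m ->
  time (E (l - 1)) - dot (velocity F) (position (E (l - 1)))
  < time (E l) - dot (velocity F) (position (E l)).
Proof.
move=> /sees_frame_time srt lm.
pose f i := time (E i) - dot (velocity F) (position (E i)).
rewrite -[ltLHS]/(f (l - 1)) -[ltRHS]/(f l).
pose g (i : nat) := f (m + inord i).
have gsrt : sorted (relpre g <%R) (iota 0 5).
  rewrite -val_enum_ord sorted_map.
  move: srt; rewrite sorted_map; apply: sub_sorted => a b /=.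
  by rewrite /g !inord_val !permE.
have step i : (i < 4)%N -> g i < g i.+1.
  by case: i gsrt => [|[|[|[|]]]] //=; case/and5P.
have [i i4 li] : exists2 i : 'I_5, (0 < i)%N & l = m + i.
  exists (l - m); last by rewrite addrC subrK.
  by rewrite lt0n; apply: contraNneq lm => e; rewrite -subr_eq0; apply/eqP/val_inj.
have ltp : (i.-1 < 4)%N by rewrite -ltnS prednK.
have := step _ ltp; rewrite prednK // /g inord_val -li.
rewrite (_ : m + inord i.-1 = l - 1) // li -addrA; congr (_ + _); apply: val_inj.
rewrite /= inordK; last exact: ltnW.
by case: i i4 {ltp li} => [[|[|[|[|[|]]]]]].
Qed.

Lemma Q0_not_realizable (R : realType) (E : 'I_5 -> event R) (F : 'I_5 -> frame R) :
  ~ realizes E F Q0.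
Proof.
move=> [p [pQ0 EF]].
have frame_of m : exists i, p i == shift m.
  by have := shift_Q0 m; rewrite pQ0 => /imsetP[i _ ->]; exists i.
pose g m := F (xchoose (frame_of m)).
have gsees m : sees E (g m) (shift m).
  by have := EF (xchoose (frame_of m)); rewrite (eqP (xchooseP (frame_of m))).
have [c [m cm] [c0 cv]] := velocities_dependent (fun m => velocity (g m)).
suff c_eq0 : forall m, c m = 0 by rewrite c_eq0 eqxx in cm.
pose T m l := time (E l) - dot (velocity (g m)) (position (E l)).
apply: (@cyclic_orders_independent _ _ T) => // [k l|l].
  exact: sees_shift.
(* The vanishing sum of coefficients removes the rest-frame times, and the affine relation of the
   velocities removes the spatial terms. *)
pose d k := dot (velocity (g k)) (position (E l)).
rewrite (eq_bigr (fun k => c k * time (E l) - c k * d k)).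
  by rewrite sumrB cv -mulr_suml c0 mul0r subrr.
by move=> k _; rewrite mulrBr.
Qed.

Local Close Scope ring_scope.

Theorem mainTheorem4 (R : realType) (Q : {set 'S_5})
    (cardQ : #|Q| = 5) (idQ : (1%g : 'S_5) \in Q) :
  (Q <> Q0 ->
     exists (E : 'I_5 -> event R) (F : 'I_5 -> frame R), realizes E F Q) /\
  (Q = Q0 ->
     ~ exists (E : 'I_5 -> event R) (F : 'I_5 -> frame R), realizes E F Q).
Proof.
split=> [|-> [E [F]]]; first exact: realizable_not_Q0.
exact: Q0_not_realizable.
Qed.
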